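(* Let $n\ge 1$ be an integer and let $\tilde n=4n-1$. Let $\mathbf{F}=\mathbf{F}_{\tilde n}$ be the $\tilde n\times\tilde n$ unitary discrete Fourier transform matrix and let $\mathcal{S}_z:\mathbb{C}^n\to\mathbb{C}^{4n-1}$ be the map $$\mathcal{S}_z(\mathbf{x})=(\underbrace{0,\dots,0}_{n},x_0,\dots,x_{n-1},\overline{x_{n-1}},\dots,\overline{x_0},\underbrace{0,\dots,0}_{n-1})^T .$$ Then the $\tilde n$ absolute-square Fourier measurements $|\mathbf{F}\mathcal{S}_z(\mathbf{x})|^2$ are stable up to a global sign for $\mathbf{x}\in\mathbb{C}^n$; that is, for all $\mathbf{x}_1,\mathbf{x}_2\in\mathbb{C}^n$, $$\left\| |\mathbf{F}\mathcal{S}_z(\mathbf{x}_1)|^2-|\mathbf{F}\mathcal{S}_z(\mathbf{x}_2)|^2\right\|\ \ge\ 2c\,\|\mathbf{x}_1-\mathbf{x}_2\|\,\|\mathbf{x}_1+\mathbf{x}_2\|$$ with $c=c(\tilde n)=\alpha_{\tilde n}/\sqrt{\tilde n}>0$, where $\alpha_{\tilde n}>0$ is a lower norm-multiplicativity constant for zero-padded circular convolution in dimension $\tilde n$ (defined in the context).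
   Context: Vectors are indexed from $0$, so $\mathbf{x}=(x_0,\dots,x_{n-1})^T$; $\|\cdot\|$ is the Euclidean ($\ell^2$) norm; for a vector $\mathbf{v}$, $|\mathbf{v}|^2$ is the vector of componentwise squared moduli $(|v_k|^2)_k$. The DFT matrix is $(\mathbf{F}_m)_{kl}=m^{-1/2}\exp(2\pi i\,kl/m)$ for $k,l\in\{0,\dots,m-1\}$ (it is unitary). The circular convolution of $\mathbf{u},\mathbf{v}\in\mathbb{C}^N$ is $(\mathbf{u}\circledast\mathbf{v})_k=\sum_{l=0}^{N-1}u_l v_{(k-l)\bmod N}$. For an integer $m\ge1$, $\alpha_m$ denotes a constant $\alpha_m>0$ such that $$\alpha_m\|\mathbf{u}\|\,\|\mathbf{v}\|\le\|(\mathbf{u},\mathbf{0})\circledast(\mathbf{v},\mathbf{0})\|\quad\text{for all }\mathbf{u},\mathbf{v}\in\mathbb{C}^m,$$ where $(\mathbf{u},\mathbf{0}),(\mathbf{v},\mathbf{0})\in\mathbb{C}^{2m-1}$ are the vectors padded by $m-1$ zeros and $\circledast$ is circular convolution in $\mathbb{C}^{2m-1}$. Such a positive constant, depending only on $m$, exists for every $m$ (a known earlier result). *)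

(* Defs.v *)
From mathcomp Require Import all_boot all_order all_algebra.
From mathcomp Require Import complex.
From mathcomp Require Import all_classical all_reals all_analysis.

Set Implicit Arguments.
Unset Strict Implicit.
Unset Printing Implicit Defensive.

Import Order.TTheory GRing.Theory Num.Theory.
Local Open Scope ring_scope.
Local Open Scope complex_scope.

(* The field of complex numbers is [R[i]], for [R : realType]; vectors are
   column vectors, whose indices start at 0. *)

Definition l2norm (R : realType) (n : nat) (v : 'cV[R[i]]_n) : R :=
  Num.sqrt (\sum_(k < n) ComplexField.Normc.normc (v k 0) ^+ 2).

(* |v|^2. The library modulus of [R[i]] takes its values in [R[i]]; all entries
   of the result are real, so that [l2norm] is their norm in R^n too. *)
Definition sqmod (R : realType) (n : nat) (v : 'cV[R[i]]_n) : 'cV[R[i]]_n :=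
  \col_(k < n) (`|v k 0| ^+ 2).

(* exp(i t), by Euler's formula *)
Definition expi (R : realType) (t : R) : R[i] := cos t +i* sin t.

Definition dft (R : realType) (m : nat) : 'M[R[i]]_m :=
  \matrix_(k < m, l < m)
    (((Num.sqrt (m%:R : R))^-1)%:C * expi (2 * pi * (k * l)%N%:R / m%:R : R)).

Definition entries (R : realType) (n : nat) (v : 'cV[R[i]]_n) : seq R[i] :=
  [seq v i 0 | i <- enum 'I_n].

(* The vector listing [s]; only used below with [size s = n]. *)
Definition vec_of_seq (R : realType) (n : nat) (s : seq R[i]) : 'cV[R[i]]_n :=
  \col_(k < n) (nth 0 s k).

(* (k - l) mod N; the subtraction of naturals is not truncated, as l < N. *)
Definition ord_subm (N : nat) (k l : 'I_N) : 'I_N :=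
  Ordinal (ltn_pmod (k + (N - l))%N (leq_ltn_trans (leq0n k) (ltn_ord k))).

Definition circ_conv (R : realType) (N : nat) (u v : 'cV[R[i]]_N) :
    'cV[R[i]]_N :=
  \col_(k < N) (\sum_(l < N) u l 0 * v (ord_subm k l) 0).

Definition zero_pad (R : realType) (m : nat) (u : 'cV[R[i]]_m) :
    'cV[R[i]]_(2 * m - 1) :=
  vec_of_seq (2 * m - 1) (entries u ++ nseq (m - 1) 0).

Definition lower_conv_const (R : realType) (m : nat) (alpha : R) : Prop :=
  0 < alpha /\
  forall u v : 'cV[R[i]]_m,
    alpha * l2norm u * l2norm v <= l2norm (circ_conv (zero_pad u) (zero_pad v)).

Definition Sz (R : realType) (n : nat) (x : 'cV[R[i]]_n) :
    'cV[R[i]]_(4 * n - 1) :=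
  vec_of_seq (4 * n - 1)
    (nseq n 0 ++ entries x ++ rev [seq z^*%C | z <- entries x]
       ++ nseq (n - 1) 0).

(* Main.v *)
Require Import Defs.
From mathcomp Require Import all_boot all_order all_algebra.
From mathcomp Require Import complex.
From mathcomp Require Import all_classical all_reals all_analysis.
From mathcomp Require Import ring lra zify.

Set Implicit Arguments.
Unset Strict Implicit.
Unset Printing Implicit Defensive.

Import Order.TTheory GRing.Theory Num.Theory.
Local Open Scope ring_scope.

(* S(x) is conjugate-symmetric under k |-> -k mod N, N = 4n - 1, so F S(x) is
   real and |F S(x1)|^2 - |F S(x2)|^2 is the entrywise product of F S(x1 - x2)
   and F S(x1 + x2). By the convolution theorem and unitarity its norm is
   N^(-1/2) |S(x1 - x2) * S(x1 + x2)|, and zero-padding both factors does not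
   change the norm of this convolution; finally |S(x)|^2 = 2 |x|^2.

   A constant alpha_m exists because any m of the 2m - 1 Fourier coefficients of
   (u, 0) determine u, by an invertible Vandermonde system. Hence at most m - 1
   coefficients are small compared to |u|, likewise for v, and at one of the
   remaining frequencies both are large. *)

(** * Roots of unity and unitarity of the DFT *)

Lemma expi0 (R : realType) : expi (0 : R) = 1.
Proof. by rewrite /expi cos0 sin0. Qed.

Lemma expiD (R : realType) (s t : R) : expi (s + t) = expi s * expi t.
Proof.
by apply/eqP; rewrite eq_complex /= cosD sinD eqxx /= addrC (mulrC (sin s)).
Qed.

Lemma expiMn (R : realType) (t : R) k : expi (t *+ k) = expi t ^+ k.
Proof.
by elim: k => [|k IHk]; rewrite ?expi0 // mulrS expiD IHk exprS.
Qed.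

Lemma expi_conjM (R : realType) (t : R) : (expi t)^*%C * expi t = 1.
Proof.
apply/eqP; rewrite eq_complex /= mulNr opprK -!expr2 cos2Dsin2 eqxx /=.
by rewrite mulNr mulrC subrr.
Qed.

(** By the half-angle formula the real part is [1 - 2 sin(t/2)^2], and [sin (t / 2) > 0] on this
    range. *)
Lemma expi_neq1 (R : realType) (t : R) : 0 < t < 2 * pi -> expi t != 1.
Proof.
move=> /andP[t0 t2]; have th : t = (t / 2) *+ 2 by rewrite -mulr_natr; field.
have sh : 0 < sin (t / 2) by apply: sin_gt0_pi; apply/andP; split; lra.
apply/eqP => -[+ _]; rewrite th cos_mulr2n => h.
by have := cos2Dsin2 (t / 2); have := exprn_gt0 2 sh; lra.
Qed.

Definition dft_root (R : realType) (m : nat) : R[i] := expi (2 * pi / m%:R).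

Lemma dft_root_prim (R : realType) m :
  (0 < m)%N -> m.-primitive_root (dft_root R m).
Proof.
move=> m0; have mR : m%:R != 0 :> R by rewrite pnatr_eq0 -lt0n.
apply/andP; split=> //; apply/forallP => i.
apply/eqP; rewrite unity_rootE -expiMn.
have [->|im] := eqVneq i.+1 m.
  by rewrite -[X in expi X]mulr_natr divfK // mulr_natl /expi
    cos2pi sin_mulr2n sinpi mulr0 mul0rn eqxx.
apply/negbTE/expi_neq1; have iltm : (i.+1 < m)%N by rewrite ltn_neqAle im ltn_ord.
have pi0 := pi_gt0 R.
rewrite -(mulr_natr (_ / _)) mulr_gt0 ?divr_gt0 ?mulr_gt0 ?ltr0n //=.
by rewrite -mulrA gtr_pMr ?mulr_gt0 // mulrC ltr_pdivrMr ?ltr0n // mul1r ltr_nat.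
Qed.

Lemma conjcM (R : realType) (x y : R[i]) : (x * y)^*%C = x^*%C * y^*%C.
Proof. exact: rmorphM. Qed.

Lemma conjcX (R : realType) (x : R[i]) k : (x ^+ k)^*%C = x^*%C ^+ k.
Proof. exact: rmorphXn. Qed.

Lemma dft_root_conjM (R : realType) m k :
  (dft_root R m ^+ k)^*%C * dft_root R m ^+ k = 1.
Proof. by rewrite conjcX -exprMn expi_conjM expr1n. Qed.

Lemma dft_entry (R : realType) m (k l : 'I_m) :
  dft R m k l = ((Num.sqrt (m%:R : R))^-1)%:C%C * dft_root R m ^+ (k * l).
Proof. by rewrite mxE -expiMn -(mulr_natr (_ / _)) mulrAC. Qed.

Lemma dft_mulE (R : realType) m (u : 'cV[R[i]]_m) k :
  (dft R m *m u) k 0 =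
  ((Num.sqrt (m%:R : R))^-1)%:C%C * \sum_(l < m) dft_root R m ^+ (k * l) * u l 0.
Proof.
by rewrite mxE mulr_sumr; apply: eq_bigr => l _; rewrite dft_entry mulrA.
Qed.

Definition adjc (R : realType) (m p : nat) (A : 'M[R[i]]_(m, p)) : 'M[R[i]]_(p, m) :=
  (map_mx conjc A)^T.

Lemma adjcM (R : realType) (m p q : nat) (A : 'M[R[i]]_(m, p)) (B : 'M[R[i]]_(p, q)) :
  adjc (A *m B) = adjc B *m adjc A.
Proof. by rewrite /adjc map_mxM trmx_mul. Qed.

Lemma dft_unitary (R : realType) m : adjc (dft R m) *m dft R m = 1%:M.
Proof.
case: m => [|m]; first by apply/matrixP => -[].
apply/matrixP => i j; rewrite !mxE.
have n0 : (m.+1)%:R != 0 :> R[i] by rewrite pnatr_eq0.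
set c := ((Num.sqrt (m.+1%:R : R))^-1)%:C%C : R[i].
have c2 : c * c = m.+1%:R^-1.
  by rewrite -rmorphM /= -invfM -expr2 sqr_sqrtr ?ler0n // fmorphV rmorph_nat.
have cJ : c^*%C = c by rewrite /c conjc_real.
have wp := @dft_root_prim R m.+1 isT; set w := dft_root R m.+1 in wp *.
(* Since [w] has modulus 1, [z] is [w^(j - i)], written without negative exponents. The inner
   product of columns [i] and [j] is a geometric sum in [z]. *)
pose z := (w ^+ i)^*%C * w ^+ j.
have -> : \sum_k (adjc (dft R m.+1)) i k * dft R m.+1 k j =
          m.+1%:R^-1 * \sum_(k < m.+1) z ^+ k.
  rewrite mulr_sumr; apply: eq_bigr => k _.
  rewrite mxE mxE !dft_entry -/w -/c conjcM cJ -c2 /z exprMn.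
  by rewrite -conjcX -!exprM !(mulnC k); ring.
have [ij|ij] := eqVneq i j.
  rewrite (eq_bigr (fun=> 1)) => [|k _]; last by rewrite /z ij dft_root_conjM expr1n.
  by rewrite sumr_const card_ord mulVf.
have z1 : z - 1 != 0.
  rewrite subr_eq0; apply: contra ij => /eqP zE.
  have : w ^+ i == w ^+ j.
    rewrite -[w ^+ j]mul1r -(dft_root_conjM R m.+1 i) -/w mulrAC.
    by rewrite -/z zE mul1r.
  by rewrite (eq_prim_root_expr wp) !modn_small // => /eqP /val_inj ->.
have : (z - 1) * (\sum_(k < m.+1) z ^+ k) = 0.
  rewrite -subrX1 /z exprMn -conjcX -!exprM !(mulnC _ m.+1) !exprM.
  by rewrite (prim_expr_order wp) !expr1n conjc1 mul1r subrr.
by move/eqP; rewrite mulf_eq0 (negbTE z1) /= => /eqP ->; rewrite mulr0.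
Qed.

(** * Norm identities, the convolution theorem and real spectra *)

Lemma sqr_l2norm (R : realType) n (v : 'cV[R[i]]_n) :
  l2norm v ^+ 2 = \sum_(k < n) ComplexField.Normc.normc (v k 0) ^+ 2.
Proof. by rewrite sqr_sqrtr // sumr_ge0 // => k _; rewrite sqr_ge0. Qed.

Lemma l2norm_ge0 (R : realType) n (v : 'cV[R[i]]_n) : 0 <= l2norm v.
Proof. exact: sqrtr_ge0. Qed.

Lemma normr_normc (R : realType) (z : R[i]) :
  `|z| = (ComplexField.Normc.normc z)%:C%C.
Proof. by []. Qed.

Lemma sqr_l2norm_adjc (R : realType) n (v : 'cV[R[i]]_n) :
  (l2norm v ^+ 2)%:C%C = (adjc v *m v) 0 0.
Proof.
rewrite sqr_l2norm rmorph_sum mxE; apply: eq_bigr => k _.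
by rewrite rmorphXn /= -normr_normc sqr_normc !mxE mulrC.
Qed.

Lemma l2norm_dft (R : realType) m (u : 'cV[R[i]]_m) :
  l2norm (dft R m *m u) = l2norm u.
Proof.
apply/(pexpIrn (n := 2)) => //; rewrite ?nnegrE ?l2norm_ge0 //.
apply: (@complexI R); rewrite !sqr_l2norm_adjc adjcM -mulmxA (mulmxA _ (dft R m)).
by rewrite dft_unitary mul1mx.
Qed.

Lemma l2normZ (R : realType) n (a : R) (v : 'cV[R[i]]_n) :
  l2norm (a%:C%C *: v) = `|a| * l2norm v.
Proof.
rewrite /l2norm -sqrtr_sqr -sqrtrM ?sqr_ge0 // mulr_sumr; congr Num.sqrt.
apply: eq_bigr => k _; rewrite mxE ComplexField.Normc.normcM exprMn.
by rewrite /= expr0n addr0 sqr_sqrtr ?sqr_ge0.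
Qed.

Definition mul_cV (R : realType) n (u v : 'cV[R[i]]_n) : 'cV[R[i]]_n :=
  \col_k (u k 0 * v k 0).

Lemma ord_subm_inj N (l : 'I_N) : injective (fun k => ord_subm k l).
Proof.
move=> i j /(congr1 val) /= /eqP; rewrite eqn_modDr !modn_small //.
by move/eqP/val_inj.
Qed.

(** The factor sqrt(N) comes from the unitary normalization: the left side carries N^(-1/2) once,
    the product on the right carries it twice. *)
Lemma dft_circ_conv (R : realType) N (u v : 'cV[R[i]]_N) :
  dft R N *m circ_conv u v =
  (Num.sqrt (N%:R : R))%:C%C *: mul_cV (dft R N *m u) (dft R N *m v).
Proof.
apply/matrixP => k j; rewrite (ord1 j) {j}.
have N0 : (0 < N)%N by case: k => k; apply: leq_ltn_trans.
have s0 : (Num.sqrt (N%:R : R))%:C%C != 0 :> R[i].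
  by rewrite (inj_eq (@complexI R)) sqrtr_eq0 -ltNge ltr0n.
have wp := dft_root_prim R N0.
rewrite [RHS]mxE [in RHS]mxE !dft_mulE fmorphV /=.
set s := (_)%:C%C in s0 *; set w := dft_root R N in wp *.
have sE A B : s * ((s^-1 * A) * (s^-1 * B)) = s^-1 * (A * B) by field.
rewrite sE; congr (_ * _).
rewrite mulr_suml.
under eq_bigr => l _ do rewrite mxE mulr_sumr.
rewrite exchange_big; apply: eq_bigr => j _ /=.
(* For fixed [j], the shift [l |-> l - j mod N] permutes the indices; the characters then agree
   because [j + (l - j) = l] modulo N. *)
rewrite [in RHS](reindex_inj (@ord_subm_inj N j)) mulr_sumr.
apply: eq_bigr => l _; rewrite mulrACA -exprD; congr (_ * _).
apply/eqP; rewrite (eq_prim_root_expr wp) -mulnDr -modnMmr -[in eqbRHS]modnMmr.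
have lj : (j + (l + (N - j)) = l + N)%N by have := ltn_ord j; lia.
by rewrite [in eqbRHS]/= modnDmr lj modnDr.
Qed.

(** The divisibility condition encodes [m = -l mod N], including the self-paired index 0.
    Conjugating the transform and substituting [l |-> -l] restores the same sum. *)
Lemma conj_fixed_dft (R : realType) N (u : 'cV[R[i]]_N) k :
    (forall l m : 'I_N, (N %| l + m)%N -> u m 0 = (u l 0)^*%C) ->
  ((dft R N *m u) k 0)^*%C = (dft R N *m u) k 0.
Proof.
move=> uJ; have N0 : (0 < N)%N by case: k => k; apply: leq_ltn_trans.
have wp := dft_root_prim R N0.
(* [h] is negation modulo N. *)
pose h (l : 'I_N) := ord_subm (Ordinal N0) l.
have hP (l : 'I_N) : (N %| l + h l)%N.
  by rewrite /dvdn /= modnDmr add0n subnKC ?modnn // ltnW.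
have h_inj : injective h.
  move=> i j hij; apply/val_inj/eqP.
  have /dvdnP[a ia] := hP i; have /dvdnP[b jb] := hP j; rewrite hij in ia.
  have : (i + h j == j + h j %[mod N])%N by rewrite ia jb !modnMl.
  by rewrite eqn_modDr !modn_small.
rewrite dft_mulE conjcM conjc_real; congr (_ * _).
rewrite [in LHS](reindex_inj h_inj) rmorph_sum; apply: eq_bigr => l _.
rewrite (uJ _ _ (hP l)) [LHS]conjcM conjcK; congr (_ * _).
rewrite -[RHS]mul1r -(dft_root_conjM R N (k * h l)) -mulrA -exprD -mulnDr addnC.
have /dvdnP[c ->] := hP l.
have w1 : dft_root R N ^+ (k * (c * N)) = 1.
  by rewrite mulnA -(prim_expr_mod wp) modnMl expr0.
by rewrite w1 mulr1.
Qed.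

(** * Structure of the symmetrized vector *)

Lemma size_entries (R : realType) n (x : 'cV[R[i]]_n) : size (entries x) = n.
Proof. by rewrite size_map size_enum_ord. Qed.

(** Extending a vector by 0 to all natural indices makes zero-padding invisible and avoids casts
    between index types. *)
Definition coef (R : realType) n (x : 'cV[R[i]]_n) (k : nat) : R[i] :=
  nth 0 (entries x) k.

Lemma coef_ord (R : realType) n (x : 'cV[R[i]]_n) (k : 'I_n) : coef x k = x k 0.
Proof.
by rewrite /coef (nth_map k) ?size_enum_ord // nth_ord_enum.
Qed.

Lemma coef_default (R : realType) n (x : 'cV[R[i]]_n) k :
  (n <= k)%N -> coef x k = 0.
Proof. by move=> nk; rewrite /coef nth_default ?size_entries. Qed.

Lemma coefD (R : realType) n (x y : 'cV[R[i]]_n) k :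
  coef (x + y) k = coef x k + coef y k.
Proof.
have [kn|nk] := ltnP k n; last by rewrite !coef_default ?addr0.
by rewrite -[k]/(val (Ordinal kn)) !coef_ord mxE.
Qed.

Lemma coefN (R : realType) n (x : 'cV[R[i]]_n) k : coef (- x) k = - coef x k.
Proof.
have [kn|nk] := ltnP k n; last by rewrite !coef_default ?oppr0.
by rewrite -[k]/(val (Ordinal kn)) !coef_ord mxE.
Qed.

Lemma coef_zero_pad (R : realType) m (u : 'cV[R[i]]_m) (k : 'I_(2 * m - 1)) :
  zero_pad u k 0 = coef u k.
Proof.
rewrite mxE nth_cat size_entries nth_nseq if_same.
by case: ltnP => // mk; rewrite coef_default.
Qed.

(** The boolean multiplicity yields the zero tail; the truncated subtraction [3 * n - 1 - k] is
    exact wherever that multiplicity is 1. *)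
Lemma SzE (R : realType) n (x : 'cV[R[i]]_n) (k : 'I_(4 * n - 1)) :
  Sz x k 0 = if (k < 2 * n)%N then (if (k < n)%N then 0 else coef x (k - n))
             else (coef x (3 * n - 1 - k))^*%C *+ (k < 3 * n)%N.
Proof.
rewrite mxE !nth_cat !nth_nseq !size_nseq !size_entries size_rev size_map
  size_entries !if_same.
have kn := ltn_ord k.
case: (ltnP k n) => k1; first by rewrite ifT //; lia.
have -> : (k - n < n)%N = (k < 2 * n)%N by lia.
case: (ltnP k (2 * n)) => k2 //.
have -> : (k - n - n < n)%N = (k < 3 * n)%N by lia.
case: ltnP => // k3; rewrite nth_rev size_map size_entries; last by lia.
rewrite (nth_map 0) ?size_entries; last by lia.
by rewrite /coef; congr (_^*%C); congr nth; lia.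
Qed.

Lemma Sz_add (R : realType) n (x y : 'cV[R[i]]_n) : Sz (x + y) = Sz x + Sz y.
Proof.
apply/matrixP => k j; rewrite (ord1 j) [RHS]mxE !SzE !coefD.
do 2?[case: ifP => _]; rewrite ?addr0 //.
by rewrite -mulrnDl -rmorphD.
Qed.

Lemma Sz_opp (R : realType) n (x : 'cV[R[i]]_n) : Sz (- x) = - Sz x.
Proof.
apply/matrixP => k j; rewrite (ord1 j) [RHS]mxE !SzE !coefN.
do 2?[case: ifP => _]; rewrite ?oppr0 //.
by rewrite -mulNrn -rmorphN.
Qed.

(** The entry x_j sits at position n + j and its conjugate at 3n - 1 - j; these positions add up to
    4n - 1. *)
Lemma Sz_conj (R : realType) n (x : 'cV[R[i]]_n) (l m : 'I_(4 * n - 1)) :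
  (4 * n - 1 %| l + m)%N -> Sz x m 0 = (Sz x l 0)^*%C.
Proof.
move=> /dvdnP[c lm]; have ln := ltn_ord l; have mn := ltn_ord m.
rewrite !SzE.
(* As [l + m < 2 (4n - 1)], either both indices are 0, where the entry is a leading zero, or they
   add up to exactly 4n - 1, which puts one of them below 2n and the other at or above it. *)
have : (c < 2)%N by nia.
case: c lm => [|[|//]] lm _.
  have [-> ->] : l = 0%N :> nat /\ m = 0%N :> nat by lia.
  by rewrite !ifT ?conjc0 //; lia.
case: (ltnP l (2 * n)) => l2; case: (ltnP m (2 * n)) => m2; try by lia.
  case: (ltnP l n) => l1; first by rewrite ltnNge (_ : 3 * n <= m)%N ?conjc0 //; lia.
  rewrite (_ : m < 3 * n)%N; last by lia.
  by congr (coef _ _)^*%C; lia.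
case: (ltnP m n) => m1.
  by rewrite ltnNge (_ : 3 * n <= l)%N ?conjc0 //; lia.
rewrite (_ : l < 3 * n)%N; last by lia.
by rewrite conjcK; congr coef; lia.
Qed.

Lemma l2norm_vec_of_seq (R : realType) n (s : seq R[i]) : size s = n ->
  l2norm (vec_of_seq n s) ^+ 2 = \sum_(z <- s) ComplexField.Normc.normc z ^+ 2.
Proof.
move=> sn; rewrite sqr_l2norm (big_nth 0) sn big_mkord.
by apply: eq_bigr => k _; rewrite mxE.
Qed.

Lemma normc_conjc (R : realType) (z : R[i]) :
  ComplexField.Normc.normc z^*%C = ComplexField.Normc.normc z.
Proof. by case: z => a b /=; rewrite sqrrN. Qed.

Lemma sum_entries (R : realType) n (x : 'cV[R[i]]_n) :
  \sum_(z <- entries x) ComplexField.Normc.normc z ^+ 2 = l2norm x ^+ 2.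
Proof. by rewrite sqr_l2norm big_map big_enum. Qed.

Lemma sqr_l2norm_Sz (R : realType) n (x : 'cV[R[i]]_n) : (0 < n)%N ->
  l2norm (Sz x) ^+ 2 = 2 * l2norm x ^+ 2.
Proof.
move=> n0; rewrite l2norm_vec_of_seq; last first.
  by rewrite !size_cat size_rev !size_nseq !size_entries size_map size_entries; lia.
have s0 k : \sum_(z <- nseq k (0 : R[i])) ComplexField.Normc.normc z ^+ 2 = 0.
  rewrite big_nseq ComplexField.Normc.normc0 expr0n.
  by elim: k => //= k ->; rewrite add0r.
rewrite !big_cat /= !s0 add0r addr0 big_rev big_map /=.
under [X in _ + X]eq_bigr => z _ do rewrite normc_conjc.
by rewrite sum_entries; ring.
Qed.

Lemma l2norm_Sz (R : realType) n (x : 'cV[R[i]]_n) : (0 < n)%N ->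
  l2norm (Sz x) = Num.sqrt 2 * l2norm x.
Proof.
move=> n0; apply/(pexpIrn (n := 2)) => //; rewrite ?nnegrE ?mulr_ge0 ?l2norm_ge0 //.
by rewrite sqr_l2norm_Sz // exprMn (@sqr_sqrtr _ 2) ?ler0n.
Qed.

(** Both transforms are real, so the squared moduli are plain squares, and a^2 - b^2 = (a - b)(a +
    b) combines with additivity of [Sz]. *)
Lemma sqmod_SzB (R : realType) n (x y : 'cV[R[i]]_n) :
  let F := dft R (4 * n - 1) in
  sqmod (F *m Sz x) - sqmod (F *m Sz y) =
  mul_cV (F *m Sz (x - y)) (F *m Sz (x + y)).
Proof.
move=> F; apply/matrixP => k j; rewrite (ord1 j).
have sq z : `|(F *m Sz z) k 0| ^+ 2 = (F *m Sz z) k 0 ^+ 2.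
  by rewrite sqr_normc conj_fixed_dft //; apply: Sz_conj.
rewrite [RHS]mxE !Sz_add Sz_opp mulmxDr mulmxN [LHS]mxE [X in X + _]mxE sq.
rewrite mulmxDr [X in _ + X]mxE [X in - X]mxE sq
  [X in _ = X * _]mxE [X in _ = _ * X]mxE.
by rewrite [X in _ = (_ + X) * _]mxE -subr_sqr.
Qed.

(** * Linear and circular convolution *)

Lemma sumr_nat_eq0 (V : nmodType) m n (F : nat -> V) :
  (forall k, (m <= k < n)%N -> F k = 0) -> \sum_(m <= k < n) F k = 0.
Proof. by move=> F0; rewrite big_nat big1. Qed.

(** This is the Cauchy product of two sequences. Working on all of [nat] gives one object to compare
    with circular convolutions of different lengths. *)
Definition lin_conv (C : pzSemiRingType) (a b : nat -> C) (k : nat) : C :=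
  \sum_(0 <= l < k.+1) a l * b (k - l)%N.

Lemma lin_conv_eq0 (C : pzSemiRingType) (a b : nat -> C) p q k :
    (forall l, ~~ (p <= l < q)%N -> a l = 0) ->
    (forall l, ~~ (p <= l < q)%N -> b l = 0) ->
  ~~ (2 * p <= k < 2 * q - 1)%N -> lin_conv a b k = 0.
Proof.
move=> ha hb hk; rewrite /lin_conv sumr_nat_eq0 // => l hl.
have [hpl|/ha ->] := boolP (p <= l < q)%N; last by rewrite mul0r.
by rewrite (hb (k - l)%N) ?mulr0 //; lia.
Qed.

(** Linear convolution of sequences supported below N lives below 2N - 1, so reduction modulo N
    folds at most one extra copy, the one at [k + N], onto index [k]. *)
Lemma circ_convE (R : realType) N (u v : 'cV[R[i]]_N) (a b : nat -> R[i])
    (k : 'I_N) :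
    (forall l : 'I_N, u l 0 = a l) -> (forall l : 'I_N, v l 0 = b l) ->
    (forall l, (N <= l)%N -> a l = 0) -> (forall l, (N <= l)%N -> b l = 0) ->
  circ_conv u v k 0 = lin_conv a b k + lin_conv a b (k + N).
Proof.
move=> ua vb a0 b0; have kN := ltn_ord k.
rewrite mxE.
under eq_bigr => l _ do rewrite ua vb /=.
rewrite -(big_mkord xpredT (fun l => a l * b ((k + (N - l)) %% N)%N)).
rewrite (big_cat_nat (n := k.+1)) //=; congr (_ + _).
  apply: eq_big_nat => l hl; congr (_ * b _).
  rewrite (_ : k + (N - l) = k - l + N)%N; last by lia.
  by rewrite modnDr modn_small //; lia.
(* In the entry at [k + N], terms with [l <= k] vanish because [b] is read at or beyond N, and terms
   with [l >= N] vanish because of [a]. The range [k < l < N] is the wrapped part. *)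
rewrite /lin_conv [RHS](big_cat_nat (n := k.+1)) //=; last by lia.
rewrite [X in _ = X + _]sumr_nat_eq0 ?add0r => [|l hl]; last first.
  by rewrite b0 ?mulr0 //; lia.
rewrite [RHS](big_cat_nat (n := N)) //=; last by lia.
rewrite [X in _ = _ + X]sumr_nat_eq0 ?addr0 => [|l hl]; last first.
  by rewrite a0 ?mul0r //; lia.
apply: eq_big_nat => l hl; congr (_ * b _).
by rewrite modn_small; lia.
Qed.

(** Length 2N - 1 is just enough to prevent wraparound. The sum runs to 2N, with one more zero term,
    so that it later splits into two blocks of length N. *)
Lemma sqr_l2norm_circ_conv_zero_pad (R : realType) N (u v : 'cV[R[i]]_N) :
    (0 < N)%N ->
  l2norm (circ_conv (zero_pad u) (zero_pad v)) ^+ 2 =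
  \sum_(0 <= k < 2 * N)
    ComplexField.Normc.normc (lin_conv (coef u) (coef v) k) ^+ 2.
Proof.
move=> N0; rewrite sqr_l2norm.
have c0 (x : 'cV[R[i]]_N) l : ~~ (0 <= l < N)%N -> coef x l = 0.
  by rewrite /= -leqNgt; apply: coef_default.
have lin0 k : (2 * N - 1 <= k)%N -> lin_conv (coef u) (coef v) k = 0.
  by move=> hk; apply: (lin_conv_eq0 (c0 u) (c0 v)); lia.
rewrite [RHS](big_cat_nat (n := (2 * N - 1)%N)) //=; last by lia.
rewrite [X in _ = _ + X]sumr_nat_eq0 ?addr0 => [|k hk]; last first.
  by rewrite lin0 ?ComplexField.Normc.normc0 ?expr0n //; lia.
rewrite big_mkord; apply: eq_bigr => k _.
rewrite (@circ_convE _ _ _ _ (coef u) (coef v)).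
- by rewrite (lin0 (k + _)%N) ?addr0 // leq_addl.
- by move=> l; rewrite coef_zero_pad.
- by move=> l; rewrite coef_zero_pad.
- by move=> l hl; rewrite coef_default //; lia.
- by move=> l hl; rewrite coef_default //; lia.
Qed.

(* The product of the two supports fits in a window of length 4n - 1, so
   reducing the linear convolution mod 4n - 1 only moves its entries. *)
Lemma l2norm_circ_conv_Sz (R : realType) n (x y : 'cV[R[i]]_n) : (0 < n)%N ->
  l2norm (circ_conv (Sz x) (Sz y)) =
  l2norm (circ_conv (zero_pad (Sz x)) (zero_pad (Sz y))).
Proof.
move=> n0; apply/(pexpIrn (n := 2)) => //; rewrite ?nnegrE ?l2norm_ge0 //.
rewrite sqr_l2norm_circ_conv_zero_pad; last by lia.
rewrite sqr_l2norm; set N := (4 * n - 1)%N; set L := lin_conv _ _.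
have c0 (z : 'cV[R[i]]_n) l : ~~ (n <= l < 3 * n)%N -> coef (Sz z) l = 0.
  move=> hl; have [lN|] := ltnP l N; last exact: coef_default.
  rewrite -[l]/(val (Ordinal lN)) coef_ord SzE /=.
  case: ltnP => l2; first by rewrite ifT //; lia.
  by rewrite (_ : (l < 3 * n)%N = false) //; lia.
have L0 k : ~~ (2 * n <= k < 6 * n - 1)%N -> L k = 0.
  by move=> hk; apply: (lin_conv_eq0 (c0 x) (c0 y)); lia.
rewrite [RHS](big_cat_nat (n := N)) //=; last by lia.
rewrite [X in _ = _ + X](_ : _ = \sum_(0 <= k < N)
    ComplexField.Normc.normc (L (k + N)%N) ^+ 2); last first.
  by rewrite -{1}[N]add0n big_addn; congr (\sum_(_ <= _ < _) _); lia.
rewrite -big_split big_mkord /=; apply: eq_bigr => k _.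
rewrite (@circ_convE _ _ _ _ (coef (Sz x)) (coef (Sz y))) -/L.
(* At most one of [L k] and [L (k + N)] is nonzero: the first vanishes for [k < 2n], and otherwise
   [k + N >= 6n - 1] lies past the window. *)
- have [k2|k2] := ltnP k (2 * n).
    by rewrite (L0 k) ?add0r ?ComplexField.Normc.normc0 ?expr0n ?add0r //; lia.
  by rewrite (L0 (k + N)%N) ?addr0 ?ComplexField.Normc.normc0 ?expr0n ?addr0 //; lia.
- by move=> l; rewrite coef_ord.
- by move=> l; rewrite coef_ord.
- exact: coef_default.
- exact: coef_default.
Qed.

(** * The stability inequality *)

Lemma stability_bound (R : realType) n (alpha : R) (x1 x2 : 'cV[R[i]]_n) :
    (0 < n)%N -> lower_conv_const (4 * n - 1) alpha ->
  2 * (alpha / Num.sqrt ((4 * n - 1)%N%:R)) * l2norm (x1 - x2) * l2norm (x1 + x2)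
    <= l2norm (sqmod (dft R (4 * n - 1) *m Sz x1) - sqmod (dft R (4 * n - 1) *m Sz x2)).
Proof.
move=> n0 [_ hconv]; rewrite sqmod_SzB.
set s := Num.sqrt _; have s0 : 0 < s by rewrite sqrtr_gt0 ltr0n; lia.
(* Scaling by [s] = sqrt(4n - 1) produces exactly the factor of the convolution theorem. *)
rewrite -(ler_pM2l s0) -[X in X * l2norm (mul_cV _ _)]gtr0_norm // -l2normZ.
rewrite -dft_circ_conv l2norm_dft l2norm_circ_conv_Sz //.
apply: le_trans (hconv _ _); rewrite !l2norm_Sz //.
(* Each of the two symmetrized vectors contributes a factor sqrt(2); together they give the 2 in the
   bound. *)
have q2 : Num.sqrt 2 * Num.sqrt 2 = 2 :> R by rewrite -expr2 sqr_sqrtr ?ler0n.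
rewrite le_eqVlt; apply/orP; left; apply/eqP.
rewrite -[in LHS]q2; field.
by rewrite gt_eqF.
Qed.

(** * Existence of a lower convolution constant *)

Lemma normc_ge0 (R : realType) (z : R[i]) : 0 <= ComplexField.Normc.normc z.
Proof. by case: z => a b; exact: sqrtr_ge0. Qed.

Lemma le_normc_l2norm (R : realType) n (v : 'cV[R[i]]_n) k :
  ComplexField.Normc.normc (v k 0) <= l2norm v.
Proof.
rewrite -(ler_pXn2r (n := 2)) ?nnegrE ?normc_ge0 ?l2norm_ge0 // sqr_l2norm.
by rewrite (bigD1 k) //= lerDl sumr_ge0 // => i _; rewrite sqr_ge0.
Qed.

Lemma normc_sum (R : realType) (I : Type) (r : seq I) (f : I -> R[i]) :
  ComplexField.Normc.normc (\sum_(i <- r) f i) <=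
  \sum_(i <- r) ComplexField.Normc.normc (f i).
Proof.
elim: r => [|i r IHr]; first by rewrite !big_nil ComplexField.Normc.normc0.
by rewrite !big_cons (le_trans (le_normcD _ _)) // lerD2l.
Qed.

Lemma l2norm_le_sum (R : realType) n (v : 'cV[R[i]]_n) :
  l2norm v <= \sum_(k < n) ComplexField.Normc.normc (v k 0).
Proof.
have S0 : 0 <= \sum_(k < n) ComplexField.Normc.normc (v k 0).
  by rewrite sumr_ge0 // => k _; rewrite normc_ge0.
rewrite -(ler_pXn2r (n := 2)) ?nnegrE ?l2norm_ge0 // sqr_l2norm.
rewrite [leRHS]expr2 mulr_suml ler_sum // => k _.
rewrite expr2 ler_wpM2l ?normc_ge0 // (bigD1 k) //= lerDl.
by rewrite sumr_ge0 // => i _; rewrite normc_ge0.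
Qed.

(** A crude bound for the operator norm from the maximum norm to the Euclidean norm; only its
    finiteness matters. *)
Definition sum_normc (R : realType) m n (A : 'M[R[i]]_(m, n)) : R :=
  \sum_i \sum_j ComplexField.Normc.normc (A i j).

Lemma sum_normc_ge0 (R : realType) m n (A : 'M[R[i]]_(m, n)) : 0 <= sum_normc A.
Proof. by do 2!rewrite sumr_ge0 // => ? _; rewrite normc_ge0. Qed.

Lemma l2norm_mul_le (R : realType) m n (A : 'M[R[i]]_(m, n))
    (v : 'cV[R[i]]_n) t :
  (forall j, ComplexField.Normc.normc (v j 0) <= t) ->
  l2norm (A *m v) <= sum_normc A * t.
Proof.
move=> vt; apply: le_trans (l2norm_le_sum _) _.
rewrite /sum_normc mulr_suml ler_sum // => i _.
rewrite mxE mulr_suml; apply: le_trans (normc_sum _ _) _.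
apply: ler_sum => j _; rewrite ComplexField.Normc.normcM.
by rewrite ler_wpM2l ?normc_ge0.
Qed.

Definition dft_minor (R : realType) m (f : 'I_m -> 'I_(2 * m - 1)) : 'M[R[i]]_m :=
  \matrix_(j, l)
    (((Num.sqrt ((2 * m - 1)%:R : R))^-1)%:C%C * dft_root R (2 * m - 1) ^+ (f j * l)).

(** Up to a nonzero scalar the minor is a transposed Vandermonde matrix, whose nodes are distinct
    powers of a primitive root. *)
Lemma dft_minor_unit (R : realType) m (f : 'I_m -> 'I_(2 * m - 1)) :
  injective f -> dft_minor R f \in unitmx.
Proof.
case: m f => [|m] f f_inj.
  by rewrite unitmxE det_mx00 unitr1.
set M := (2 * m.+1 - 1)%N; have M0 : (0 < M)%N by rewrite /M; lia.
have wp := dft_root_prim R M0.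
pose V := Vandermonde m.+1 (\row_j dft_root R M ^+ f j).
set s := ((Num.sqrt (M%:R : R))^-1)%:C%C : R[i].
have -> : dft_minor R f = s *: V^T.
  by apply/matrixP => i j; rewrite !mxE exprM.
have s0 : s != 0.
  by rewrite (inj_eq (@complexI R)) invr_eq0 sqrtr_eq0 -ltNge ltr0n.
rewrite unitmxE detZ det_tr det_Vandermonde unitfE mulf_neq0 ?expf_neq0 //.
apply/prodf_neq0 => i _; apply/prodf_neq0 => j ij; rewrite !mxE subr_eq0.
rewrite (eq_prim_root_expr wp) !modn_small //.
by apply: contraTneq ij => /val_inj /f_inj ->; rewrite ltnn.
Qed.

Lemma dft_minor_mul (R : realType) m (f : 'I_m -> 'I_(2 * m - 1)) (u : 'cV[R[i]]_m) j :
  (dft_minor R f *m u) j 0 = (dft R (2 * m - 1) *m zero_pad u) (f j) 0.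
Proof.
rewrite dft_mulE mxE mulr_sumr.
pose g l := ((Num.sqrt ((2 * m - 1)%:R : R))^-1)%:C%C *
  (dft_root R (2 * m - 1) ^+ (f j * l) * coef u l).
rewrite [LHS](eq_bigr (fun l : 'I_m => g l)) => [|l _]; last first.
  by rewrite mxE /g coef_ord mulrA.
rewrite [RHS](eq_bigr (fun l : 'I_(2 * m - 1) => g l)) => [|l _]; last first.
  by rewrite coef_zero_pad.
have m0 : (0 < m)%N by case: (j) => i; apply: leq_ltn_trans.
rewrite -!(big_mkord xpredT g) [RHS](big_cat_nat (n := m)) //=; last by lia.
rewrite [X in _ = _ + X]sumr_nat_eq0 ?addr0 // => l hl.
by rewrite /g coef_default ?mulr0 //; lia.
Qed.

(** [K] must not depend on the choice [f] of frequencies. There are finitely many choices, so the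
    bounds for the inverse minors are summed over all of them; the surplus terms are nonnegative. *)
Lemma l2norm_le_dft_minor (R : realType) m : exists2 K : R, 0 <= K &
  forall (f : 'I_m -> 'I_(2 * m - 1)) (u : 'cV[R[i]]_m) (t : R), injective f ->
    0 <= t ->
    (forall j, ComplexField.Normc.normc
       ((dft R (2 * m - 1) *m zero_pad u) (f j) 0) <= t) ->
    l2norm u <= K * t.
Proof.
exists (\sum_(g : {ffun 'I_m -> 'I_(2 * m - 1)}) sum_normc (invmx (dft_minor R g))).
  by rewrite sumr_ge0 // => g _; apply: sum_normc_ge0.
move=> f u t f_inj t0 ft; pose g := [ffun j => f j].
have g_inj : injective g by move=> i j; rewrite !ffunE => /f_inj.
rewrite -(mulKmx (dft_minor_unit R g_inj) u).
apply: le_trans (l2norm_mul_le (t := t) _ _) _ => [j|].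
  by rewrite dft_minor_mul ffunE.
rewrite ler_wpM2r // (bigD1 g) //= lerDl.
by rewrite sumr_ge0 // => h _; apply: sum_normc_ge0.
Qed.

Lemma lower_conv_const_ex (R : realType) m :
  (0 < m)%N -> exists alpha : R, lower_conv_const m alpha.
Proof.
move=> m0; have [K0 K0ge hK] := l2norm_le_dft_minor R m.
(* Adding 1 makes [K] positive and strictly larger than [K0], so that m bad frequencies would give
   the contradiction [l2norm u <= (K0 / K) * l2norm u < l2norm u]. *)
pose M := (2 * m - 1)%N; pose K := K0 + 1; have Kgt : 0 < K by rewrite ltr_wpDl.
pose hat (u : 'cV[R[i]]_m) := dft R M *m zero_pad u.
pose bad u := [set k : 'I_M | K * ComplexField.Normc.normc (hat u k 0) < l2norm u].
have card_bad u : (#|bad u| < m)%N.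
  rewrite ltnNge; apply/negP => mB.
  pose f j := enum_val (widen_ord mB j).
  have f_inj : injective f by move=> i j /enum_val_inj /(congr1 val) /= /val_inj.
  have fB j : K * ComplexField.Normc.normc (hat u (f j) 0) < l2norm u.
    by have := enum_valP (widen_ord mB j); rewrite inE.
  have u0 : 0 < l2norm u.
    apply: le_lt_trans (fB (Ordinal m0)).
    by rewrite mulr_ge0 ?normc_ge0 // ltW.
  have t0 : 0 <= l2norm u / K by rewrite divr_ge0 // ltW.
  have : l2norm u <= K0 * (l2norm u / K).
    by apply: (hK f) => // j; rewrite ler_pdivlMr // mulrC ltW.
  by rewrite mulrCA ler_pMr // ler_pdivlMr // mul1r /K gerDl ler10.
pose s : R := Num.sqrt M%:R.
have s0 : 0 < s by rewrite sqrtr_gt0 ltr0n /M; lia.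
exists (s / (K * K)); split; first by rewrite divr_gt0 ?mulr_gt0.
move=> u v.
have [k ku kv] : exists2 k, k \notin bad u & k \notin bad v.
  (* Two bad sets of at most m - 1 elements cannot cover all 2m - 1 frequencies. *)
  have : (0 < #|~: (bad u :|: bad v)|)%N.
    rewrite -(ltn_add2l #|bad u :|: bad v|) cardsC addn0 card_ord.
    apply: leq_ltn_trans (leq_card_setU _ _) _.
    have ltM a b : (a < m)%N -> (b < m)%N -> (a + b < M)%N by rewrite /M; lia.
    exact: ltM.
  case/card_gt0P => k; rewrite finset.in_setC finset.in_setU negb_or.
  by move=> /andP[]; exists k.
move: ku kv; rewrite !inE -!leNgt => ku kv.
have : l2norm u * l2norm v <=
    K * K * ComplexField.Normc.normc (mul_cV (hat u) (hat v) k 0).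
  rewrite mxE ComplexField.Normc.normcM mulrACA.
  by rewrite ler_pM ?l2norm_ge0.
(* A single good frequency suffices: the whole norm dominates that entry, and the convolution
   theorem with unitarity turns [s] times the norm into that of the convolution. *)
have := le_normc_l2norm (mul_cV (hat u) (hat v)) k.
rewrite -(ler_pM2l s0) -[X in _ <= X * _ -> _]gtr0_norm // -l2normZ.
rewrite -dft_circ_conv l2norm_dft => h1 h2.
rewrite -mulrA mulrAC ler_pdivrMr ?mulr_gt0 //.
apply: le_trans (_ : s * (K * K *
  ComplexField.Normc.normc (mul_cV (hat u) (hat v) k 0)) <= _).
  by rewrite ler_pM2l.
by rewrite mulrCA mulrC ler_pM2r ?mulr_gt0.
Qed.

Theorem mainTheorem2 (R : realType) (n : nat) (hn : (1 <= n)%N) :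
  (exists alpha : R, lower_conv_const (4 * n - 1) alpha) /\
  (forall alpha : R, lower_conv_const (4 * n - 1) alpha ->
     let F := dft R (4 * n - 1) in
     let c := alpha / Num.sqrt ((4 * n - 1)%N%:R) in
     0 < c /\
     forall x1 x2 : 'cV[R[i]]_n,
       2 * c * l2norm (x1 - x2) * l2norm (x1 + x2)
         <= l2norm (sqmod (F *m Sz x1) - sqmod (F *m Sz x2))).
Proof.
have N0 : (0 < 4 * n - 1)%N by lia.
split; first exact: lower_conv_const_ex.
move=> alpha ha F c; split; last by move=> x1 x2; apply: stability_bound.
by rewrite divr_gt0 ?sqrtr_gt0 ?ltr0n //; case: ha.
Qed.
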